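(* Let $(Co_{\mathbf{K}},i)$ be an equational filter pair over a signature $\Sigma$, with $i$ given by a finite set of equations $\delta(x)\approx\epsilon(x)$, let $X$ be a countably infinite set, and let $l=(\Sigma,\vdash^X)$ be the associated logic. Then for every $\Sigma$-structure $A$ and every $\theta\in Co_{\mathbf{K}}(A)$, $$\Xi_A(i_A(\theta))\subseteq\theta\subseteq\Omega_A(i_A(\theta)).$$ Moreover the following are equivalent: (a) one of the two inclusions is an equality for every $\theta\in Co_{\mathbf{K}}(Fm(X))$ (that is, either $\Xi_{Fm(X)}(i_{Fm(X)}(\theta))=\theta$ for every such $\theta$, or $\theta=\Omega_{Fm(X)}(i_{Fm(X)}(\theta))$ for every such $\theta$); (b) both inclusions are equalities for all $\Sigma$-structures $A$ and every $\theta\in Co_{\mathbf{K}}(A)$; (c) $\Xi_A=\Omega_A$ for all $\Sigma$-structures $A$, as maps from the lattice $Fi_l(A)$ of $l$-filters on $A$ to $Co_{\mathbf{K}}(A)$; (d) $\Xi_{Fm(X)}=\Omega_{Fm(X)}$, as maps from the lattice of theories of $l$ to $Co_{\mathbf{K}}(Fm(X))$; (e) the logic $l$ is algebraizable with $i_{Fm(X)}$ being a substitution preserving lattice isomorphism (from $Co_{\mathbf{K}}(Fm(X))$ onto the lattice of theories of $l$).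
   Context: $Fm(X)$ is the absolutely free $\Sigma$-structure (formula algebra) on $X$. A quasivariety is a class of $\Sigma$-structures axiomatizable by quasi-identities. For a quasivariety $\mathbf{K}$ and a $\Sigma$-structure $A$, $Co_{\mathbf{K}}(A)$ is the algebraic lattice (under inclusion) of congruences $\theta$ on $A$ with $A/\theta\in\mathbf{K}$; for a homomorphism $f$, $Co_{\mathbf{K}}(f)=(f\times f)^{-1}$. An equational filter pair is a pair $(Co_{\mathbf{K}},i)$ with $\mathbf{K}$ a quasivariety and $i_A:Co_{\mathbf{K}}(A)\to\mathcal{P}(A)$, $i_A(\theta)=\{a\in A\mid\langle\delta^A(a),\epsilon^A(a)\rangle\in\theta$ for all equations $\delta\approx\epsilon$ in $\tau\}$, for a fixed finite set $\tau$ of equations in at most one variable (''$i$ is given by $\tau$''). Each $i_A$ preserves arbitrary infima and directed suprema and $i$ is natural with respect to inverse images; $\Xi_A:\mathcal{P}(A)\to Co_{\mathbf{K}}(A)$ denotes the left adjoint of $i_A$ (so $\Xi_A(S)\subseteq\theta\iff S\subseteq i_A(\theta)$). The associated logic $(\Sigma,\vdash^X)$: $\Gamma\vdash^X\varphi$ iff for all $\theta\in Co_{\mathbf{K}}(Fm(X))$, $\Gamma\subseteq i_{Fm(X)}(\theta)$ implies $\varphi\in i_{Fm(X)}(\theta)$. Theories of $l$ are the $\vdash^X$-closed subsets of $Fm(X)$. An $l$-filter on $A$ is a subset $F\subseteq A$ such that whenever $\Gamma\vdash^X\varphi$ and $v:Fm(X)\to A$ is a homomorphism with $v[\Gamma]\subseteq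 F$, then $v(\varphi)\in F$. Leibniz operator: a congruence $\theta$ on $A$ is compatible with $F\subseteq A$ if $a\in F$ and $\langle a,b\rangle\in\theta$ imply $b\in F$; $\Omega_A(F)$ is the largest congruence on $A$ compatible with $F$. ''Substitution preserving'' for $\Phi=i_{Fm(X)}$ means $\Phi((\sigma\times\sigma)^{-1}(\theta))=\sigma^{-1}(\Phi(\theta))$ for every endomorphism $\sigma$ of $Fm(X)$. A logic $l$ is algebraizable (Blok–Pigozzi) if there are a class $\mathbf{K}'$ of $\Sigma$-structures, a set $\tau'$ of equations $\delta'(x)\approx\epsilon'(x)$ in one variable and a finite set $\Delta(p,q)$ of formulas in two variables such that (1) $\Gamma\vdash_l\varphi$ iff $\{\delta'(\gamma)\approx\epsilon'(\gamma)\mid\gamma\in\Gamma,\,\delta'\approx\epsilon'\in\tau'\}\models_{\mathbf{K}'}\delta'(\varphi)\approx\epsilon'(\varphi)$ for all $\delta'\approx\epsilon'\in\tau'$; (2) for every set $\Gamma$ of equations and equation $\varphi\approx\psi$, $\Gamma\models_{\mathbf{K}'}\varphi\approx\psi$ iff $\bigcup\{\Delta(\xi,\eta)\mid\xi\approx\eta\in\Gamma\}\vdash_l\Delta(\varphi,\psi)$; (3) for every formula $\psi$, $\psi$ and the set $\bigcup\{\Delta(\delta'(\psi),\epsilon'(\psi))\mid\delta'\approx\epsilon'\in\tau'\}$ are interderivable in $l$. Here $\Gamma\models_{\mathbf{K}'}\varphi\approx\psi$ means that for every $A\in\mathbf{K}'$ and homomorphism $h:Fm(X)\to A$ identifying both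 sides of every equation in $\Gamma$, $h(\varphi)=h(\psi)$. *)

(* Defs.v *)
From Stdlib Require List.
From mathcomp Require Import all_boot.
From mathcomp Require Import boolp classical_sets functions cardinality.

Set Implicit Arguments.
Unset Strict Implicit.
Unset Printing Implicit Defensive.

Local Open Scope classical_set_scope.

(* Carriers may be empty. *)

Record signature := Signature { symbol : Type; arity : symbol -> nat }.

Record structure (S : signature) := Structure {
  carrier :> Type;
  interp : forall f : symbol S, ('I_(arity f) -> carrier) -> carrier }.

Arguments interp {S} A f : rename.

Definition is_hom (S : signature) (A B : structure S) (h : A -> B) : Prop :=
  forall f (a : 'I_(arity f) -> A), h (interp A f a) = interp B f (h \o a).

Inductive term (S : signature) (X : Type) : Type :=
| Var of X
| App (f : symbol S) of 'I_(arity f) -> term S X.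

Definition Fm (S : signature) (X : Type) : structure S :=
  @Structure S (term S X) (@App S X).

Fixpoint eval (S : signature) (X : Type) (A : structure S) (v : X -> A)
    (t : term S X) : A :=
  match t with
  | Var x => v x
  | App f a => interp A f (fun i => eval v (a i))
  end.

Definition equation (S : signature) (X : Type) : Type :=
  (term S X * term S X)%type.

(* [t1 A a] is t^A(a) for a term t in at most one variable; with [A := Fm S X]
   it is the substitution instance t(a). [t2] is the same with two variables,
   [true] standing for the first one and [false] for the second one. *)
Definition t1 (S : signature) (A : structure S) (a : A) (t : term S unit) : A :=
  eval (fun=> a) t.

Definition t2 (S : signature) (A : structure S) (a b : A) (t : term S bool)
    : A :=
  eval (fun x : bool => if x then a else b) t.

(* Classes of structures live in a larger universe than [set] allows, hence
   are plain predicates. *)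

Record quasi_identity (S : signature) := QuasiIdentity {
  premises : seq (equation S nat);
  conclusion : equation S nat }.

Definition satisfies (S : signature) (A : structure S) (q : quasi_identity S)
    : Prop :=
  forall v : nat -> A,
    (forall e, List.In e (premises q) -> eval v e.1 = eval v e.2) ->
    eval v (conclusion q).1 = eval v (conclusion q).2.

Definition quasivariety (S : signature) (K : structure S -> Prop) : Prop :=
  exists Q : set (quasi_identity S),
    forall A, K A <-> (forall q, Q q -> satisfies A q).

Record is_congruence (S : signature) (A : structure S) (theta : set (A * A))
    : Prop := IsCongruence {
  cong_refl : forall a, theta (a, a);
  cong_sym : forall a b, theta (a, b) -> theta (b, a);
  cong_trans : forall a b c, theta (a, b) -> theta (b, c) -> theta (a, c);
  cong_interp : forall f (a b : 'I_(arity f) -> A),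
    (forall i, theta (a i, b i)) -> theta (interp A f a, interp A f b) }.

Section Quotient.
Variables (S : signature) (A : structure S) (theta : set (A * A)).

Definition quot_carrier : Type :=
  {C : set A | exists a, C = [set b | theta (a, b)]}.

Definition cls (a : A) : quot_carrier :=
  exist _ [set b | theta (a, b)] (ex_intro _ a erefl).

Definition repr (C : quot_carrier) : A := projT1 (cid (svalP C)).

(* The operations act on chosen representatives; when theta is a congruence
   the choice is irrelevant, see [cls_hom]. *)
Definition quotient : structure S :=
  @Structure S quot_carrier (fun f C => cls (interp A f (repr \o C))).

Lemma reprK (C : quot_carrier) : cls (repr C) = C.
Proof.
rewrite /repr; case: cid => a /= aC; case: C aC => C exC /= aC.
by apply: eq_exist.
Qed.

Hypothesis congr : is_congruence theta.

Lemma clsP (a b : A) : cls a = cls b <-> theta (a, b).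
Proof.
split=> [[ab]|ab].
  have : [set c | theta (b, c)] b by apply: (cong_refl congr).
  by rewrite -ab.
apply: eq_exist; apply/seteqP; split=> c /=.
  exact/(cong_trans congr)/(cong_sym congr).
exact: (cong_trans congr).
Qed.

Lemma cls_hom : @is_hom S A quotient cls.
Proof.
move=> f a; apply/clsP/(cong_interp congr) => i /=.
by apply/clsP; rewrite reprK.
Qed.

End Quotient.

Definition Co (S : signature) (K : structure S -> Prop) (A : structure S)
    : set (set (A * A)) :=
  [set theta | is_congruence theta /\ K (quotient theta)].

Arguments Co {S} K A _.

Definition preimage2 (A B : Type) (h : A -> B) (theta : set (B * B))
    : set (A * A) :=
  [set p | theta (h p.1, h p.2)].

Definition i_ (S : signature) (tau : set (equation S unit)) (A : structure S)
    (theta : set (A * A)) : set A :=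
  [set a | forall e, tau e -> theta (t1 a e.1, t1 a e.2)].

Arguments i_ {S} tau A theta _.

Definition Xi (S : signature) (K : structure S -> Prop)
    (tau : set (equation S unit)) (A : structure S) (F : set A)
    : set (A * A) :=
  \bigcap_(theta in [set theta | Co K A theta /\ F `<=` i_ tau A theta]) theta.

Arguments Xi {S} K tau A F _.

Definition conseq_rel (S : signature) (X : Type) : Type :=
  set (Fm S X) -> Fm S X -> Prop.

Definition assoc_logic (S : signature) (K : structure S -> Prop)
    (tau : set (equation S unit)) (X : Type) : conseq_rel S X :=
  fun Gamma phi => forall theta : set (Fm S X * Fm S X),
    Co K (Fm S X) theta -> Gamma `<=` i_ tau (Fm S X) theta ->
    i_ tau (Fm S X) theta phi.

Arguments assoc_logic {S} K tau X _ _.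

Definition is_theory (S : signature) (X : Type) (l : conseq_rel S X)
    (T : set (Fm S X)) : Prop :=
  forall phi, l T phi -> T phi.

Definition is_filter (S : signature) (X : Type) (l : conseq_rel S X)
    (A : structure S) (F : set A) : Prop :=
  forall Gamma phi (v : Fm S X -> A),
    l Gamma phi -> is_hom v -> v @` Gamma `<=` F -> F (v phi).

Arguments is_filter {S X} l A F.

Definition compatible (S : signature) (A : structure S) (theta : set (A * A))
    (F : set A) : Prop :=
  forall a b, F a -> theta (a, b) -> F b.

(* The union of all compatible congruences is itself a compatible congruence,
   hence the largest one: see [Omega_largest]. *)
Definition Omega (S : signature) (A : structure S) (F : set A) : set (A * A) :=
  \bigcup_(theta in [set theta | is_congruence theta /\ compatible theta F])
    theta.

Arguments Omega {S} A F _.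

Definition eq_conseq (S : signature) (X : Type) (K : structure S -> Prop)
    (Gamma : set (equation S X)) (e : equation S X) : Prop :=
  forall A, K A -> forall h : Fm S X -> A, is_hom h ->
    (forall g, Gamma g -> h g.1 = h g.2) -> h e.1 = h e.2.

Definition algebraizable (S : signature) (X : Type) (l : conseq_rel S X)
    : Prop :=
  exists (K : structure S -> Prop) (tau : set (equation S unit))
         (Delta : set (term S bool)),
    let tau_ (phi : Fm S X) : set (equation S X) :=
      [set (t1 phi e.1, t1 phi e.2) | e in tau] in
    let Delta_ (e : equation S X) : set (Fm S X) :=
      [set @t2 S (Fm S X) e.1 e.2 d | d in Delta] in
    [/\ finite_set Delta,
        forall Gamma phi,
          l Gamma phi <->
          (forall e, tau_ phi e ->
             eq_conseq K (\bigcup_(gamma in Gamma) tau_ gamma) e),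
        forall (Gamma : set (equation S X)) (e : equation S X),
          eq_conseq K Gamma e <->
          (forall d, Delta_ e d -> l (\bigcup_(g in Gamma) Delta_ g) d) &
        forall psi,
          (forall d, (\bigcup_(e in tau_ psi) Delta_ e) d -> l [set psi] d) /\
          l (\bigcup_(e in tau_ psi) Delta_ e) psi].

Definition is_meet (U : Type) (L : set (set U)) (x y m : set U) : Prop :=
  [/\ L m, m `<=` x, m `<=` y &
      forall z, L z -> z `<=` x -> z `<=` y -> z `<=` m].

Definition is_join (U : Type) (L : set (set U)) (x y j : set U) : Prop :=
  [/\ L j, x `<=` j, y `<=` j &
      forall z, L z -> x `<=` z -> y `<=` z -> j `<=` z].

Definition lattice_isomorphism (U V : Type) (L : set (set U)) (M : set (set V))
    (Phi : set U -> set V) : Prop :=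
  [/\ set_bij L M Phi,
      forall x y m, L x -> L y ->
        is_meet L x y m -> is_meet M (Phi x) (Phi y) (Phi m) &
      forall x y j, L x -> L y ->
        is_join L x y j -> is_join M (Phi x) (Phi y) (Phi j)].

Definition substitution_preserving (S : signature) (X : Type)
    (L : set (set (Fm S X * Fm S X)))
    (Phi : set (Fm S X * Fm S X) -> set (Fm S X)) : Prop :=
  forall sigma : Fm S X -> Fm S X, is_hom sigma ->
  forall theta, L theta ->
    Phi (preimage2 sigma theta) = sigma @^-1` (Phi theta).

Lemma eval_hom (S : signature) (X : Type) (A B : structure S) (h : A -> B)
    (v : X -> A) (t : term S X) :
  is_hom h -> h (eval v t) = eval (h \o v) t.
Proof.
move=> hh; elim: t => //= f a IH; rewrite hh; congr (interp B f _).
by apply/funext => i /=; exact: IH.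
Qed.

Lemma satisfies_quotient (S : signature) (A : structure S)
    (theta : set (A * A)) (q : quasi_identity S) :
  is_congruence theta ->
  satisfies (quotient theta) q <->
  (forall v : nat -> A,
    (forall e, List.In e (premises q) -> theta (eval v e.1, eval v e.2)) ->
    theta (eval v (conclusion q).1, eval v (conclusion q).2)).
Proof.
move=> C; have H := cls_hom C; split=> sat v prem.
  apply/(clsP C); rewrite !(eval_hom _ _ H); apply: sat => e /prem.
  by rewrite -!(eval_hom _ _ H) => /(clsP C).
have [w vw] : exists w, v = @cls S A theta \o w.
  by exists (@repr S A theta \o v); apply/funext => n /=; rewrite reprK.
subst v; rewrite -!(eval_hom _ _ H); apply/(clsP C)/sat => e /prem.
by rewrite -!(eval_hom _ _ H) => /(clsP C).
Qed.

Lemma Co_bigcap (S : signature) (K : structure S -> Prop) (A : structure S)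
    (D : set (set (A * A))) :
  quasivariety K -> D `<=` Co K A -> Co K A (\bigcap_(theta in D) theta).
Proof.
move=> [Q KQ] DCo.
have C : is_congruence (\bigcap_(theta in D) theta).
  split.
  - by move=> a t Dt; have [Ct _] := DCo t Dt; exact: (cong_refl Ct).
  - by move=> a b ab t Dt; have [Ct _] := DCo t Dt; apply: (cong_sym Ct); exact: ab.
  - move=> a b c ab bc t Dt; have [Ct _] := DCo t Dt.
    by apply: (cong_trans Ct); [exact: ab | exact: bc].
  - move=> f a b ab t Dt; have [Ct _] := DCo t Dt.
    by apply: (cong_interp Ct) => i; exact: ab.
split=> //; apply/KQ => q Qq; apply/(satisfies_quotient _ C) => v prem t Dt.
have [Ct /KQ/(_ q Qq)/(satisfies_quotient _ Ct)] := DCo t Dt.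
by apply=> e /prem; exact.
Qed.

Lemma Xi_Co (S : signature) (K : structure S -> Prop)
    (tau : set (equation S unit)) (A : structure S) (F : set A) :
  quasivariety K -> Co K A (Xi K tau A F).
Proof. by move=> qK; apply: Co_bigcap => // theta []. Qed.

Lemma Xi_adjoint (S : signature) (K : structure S -> Prop)
    (tau : set (equation S unit)) (A : structure S) (F : set A)
    (theta : set (A * A)) :
  Co K A theta -> Xi K tau A F `<=` theta <-> F `<=` i_ tau A theta.
Proof.
move=> Ct; split=> [le a Fa e te|le]; last exact: bigcap_inf.
by apply: le => t [_ Ft]; exact: Ft.
Qed.

Section OmegaLargest.
Variables (S : signature) (A : structure S) (F : set A).

Inductive Omega_chain : A -> A -> Prop :=
| Chain_refl a : Omega_chain a a
| Chain_step a b c :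
    Omega A F (a, b) -> Omega_chain b c -> Omega_chain a c.

Lemma Omega_sym a b : Omega A F (a, b) -> Omega A F (b, a).
Proof. by move=> [t [Ct ?] ab]; exists t => //; apply: (cong_sym Ct). Qed.

Lemma Chain_trans a b c : Omega_chain a b -> Omega_chain b c -> Omega_chain a c.
Proof.
by elim=> // a' b' c' ab _ IH /IH; exact: (Chain_step ab).
Qed.

Lemma Chain_sym a b : Omega_chain a b -> Omega_chain b a.
Proof.
elim=> [?|a' b' c' ab _ IH]; first exact: Chain_refl.
apply: (Chain_trans IH); apply: (Chain_step (Omega_sym ab)).
exact: Chain_refl.
Qed.

Lemma Chain_interp1 f (a : 'I_(arity f) -> A) (j : 'I_(arity f)) x y :
  Omega_chain x y ->
  Omega_chain (interp A f (fun i => if i == j then x else a i))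
              (interp A f (fun i => if i == j then y else a i)).
Proof.
elim=> [?|u v w [t [Ct Ft] uv] _]; first exact: Chain_refl.
apply: Chain_step; exists t => //; apply: (cong_interp Ct) => i.
by case: eqP => // _; exact: (cong_refl Ct).
Qed.

Lemma Chain_interp f (a b : 'I_(arity f) -> A) :
  (forall i, Omega_chain (a i) (b i)) ->
  Omega_chain (interp A f a) (interp A f b).
Proof.
move=> ab.
have step n : n <= arity f ->
    Omega_chain (interp A f a) (interp A f (fun i => if i < n then b i else a i)).
  elim: n => [_|n IH lt]; first exact: Chain_refl.
  apply: (Chain_trans (IH (ltnW lt))).
  pose j := Ordinal lt; set g := fun i : 'I_(arity f) => if i < n then b i else a i.
  have := @Chain_interp1 f g j _ _ (ab j).
  congr Omega_chain; congr (interp A f _); apply/funext => i; rewrite /g.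
    by case: eqP => // ->; rewrite /= ltnn.
  case: eqP => [->|ne]; first by rewrite /= ltnSn.
  by rewrite ltnS [i <= n]leq_eqVlt; case: eqP => // e; case: ne; apply: val_inj.
have := step _ (leqnn _); congr Omega_chain; congr (interp A f _).
by apply/funext => i; rewrite ltn_ord.
Qed.

Lemma Omega_largest :
  [/\ is_congruence (Omega A F), compatible (Omega A F) F &
      forall theta, is_congruence theta -> compatible theta F ->
        theta `<=` Omega A F].
Proof.
have max theta : is_congruence theta -> compatible theta F ->
    theta `<=` Omega A F by move=> Ct Ft p pt; exists theta.
have comp : compatible (Omega A F) F.
  by move=> a b Fa [t [_ Ft]]; exact: Ft.
suff : Omega A F = [set p | Omega_chain p.1 p.2].
  split=> //; rewrite H; split.
  - by move=> a; exact: Chain_refl.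
  - by move=> a b; exact: Chain_sym.
  - by move=> a b c; exact: Chain_trans.
  - by move=> f a b; exact: Chain_interp.
apply/seteqP; split=> [[a b] ab|].
  exact: (Chain_step ab (Chain_refl b)).
apply: max; last first.
  by move=> a b Fa /= ab; elim: ab Fa => // u v w uv _ IH Fu;
    apply/IH/(comp _ _ Fu uv).
split.
- by move=> a; exact: Chain_refl.
- by move=> a b; exact: Chain_sym.
- by move=> a b c; exact: Chain_trans.
- by move=> f a b; exact: Chain_interp.
Qed.

End OmegaLargest.

(* Main.v *)
Require Import Defs.
From mathcomp Require Import all_boot.
From mathcomp Require Import boolp classical_sets functions cardinality.

Set Implicit Arguments.
Unset Strict Implicit.
Unset Printing Implicit Defensive.

Local Open Scope classical_set_scope.

(** Everything reduces to a finite set of formulas Delta(p, q) with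
    (a, b) in theta iff Delta(a, b) is contained in i_A(theta), for all A and all
    theta in Co_K(A). If Xi (i theta) = theta for all theta on Fm(X), apply this
    to the K-congruence theta0 generated by a pair of distinct variables (p, q):
    as Xi is finitary, (p, q) lies in Xi(D) for some finite D contained in
    i(theta0), and Delta arises from D by identifying all variables other than q
    with p. Given Delta, membership in theta can be read off i_A(theta), which
    yields both equalities on every A. Moreover every filter F of the logic
    equals i_A(theta) for theta = {(a, b) | Delta(a, b) contained in F}, which is a
    K-congruence because Delta translates the quasi-identities of K into rules of
    the logic. *)

(** * Evaluation, congruences and inverse images *)

Lemma eval_is_hom (S : signature) (X : Type) (A : structure S) (v : X -> A) :
  @is_hom S (Fm S X) A (eval v).
Proof. by []. Qed.

Lemma eval_cong (S : signature) (X : Type) (A : structure S)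
    (theta : set (A * A)) (v w : X -> A) (t : term S X) :
  is_congruence theta -> (forall x, theta (v x, w x)) ->
  theta (eval v t, eval w t).
Proof. by move=> C vw; elim: t => //= f a IH; apply: (cong_interp C). Qed.

Lemma hom_t1 (S : signature) (A B : structure S) (h : A -> B) (a : A)
    (t : term S unit) : is_hom h -> h (t1 a t) = t1 (h a) t.
Proof. by move=> hh; rewrite /t1 (eval_hom _ _ hh). Qed.

Lemma hom_t2 (S : signature) (A B : structure S) (h : A -> B) (a b : A)
    (t : term S bool) : is_hom h -> h (t2 a b t) = t2 (h a) (h b) t.
Proof.
move=> hh; rewrite /t2 (eval_hom _ _ hh); congr (eval _ t).
by apply/funext; case.
Qed.

Lemma is_congruence_preimage2 (S : signature) (A B : structure S) (h : A -> B)
    (theta : set (B * B)) :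
  is_hom h -> is_congruence theta -> is_congruence (preimage2 h theta).
Proof.
move=> hh C; split; rewrite /preimage2 /=.
- by move=> a; exact: (cong_refl C).
- by move=> a b; exact: (cong_sym C).
- by move=> a b c; exact: (cong_trans C).
- by move=> f a b ab; rewrite !hh; exact: (cong_interp C).
Qed.

Lemma i_compatible (S : signature) (tau : set (equation S unit))
    (A : structure S) (theta : set (A * A)) :
  is_congruence theta -> compatible theta (i_ tau A theta).
Proof.
move=> C a b ia ab e te.
apply: (cong_trans C (b := t1 a e.1)); first exact: (eval_cong _ C (fun=> cong_sym C ab)).
apply: (cong_trans C (ia e te)).
exact: (eval_cong _ C (fun=> ab)).
Qed.

Lemma i_preimage2 (S : signature) (tau : set (equation S unit))
    (A B : structure S) (h : A -> B) (theta : set (B * B)) :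
  is_hom h -> i_ tau A (preimage2 h theta) = h @^-1` i_ tau B theta.
Proof.
move=> hh; apply/seteqP; split=> a ia e te; have := ia e te;
  by rewrite /preimage2 /= !(hom_t1 _ _ hh).
Qed.

(** * The adjunction between [Xi] and [i_], and its finitarity *)

Section Quasivariety.
Context (S : signature) (K : structure S -> Prop) (hK : quasivariety K).
Context (tau : set (equation S unit)).

Lemma Co_preimage2 (A B : structure S) (h : A -> B) (theta : set (B * B)) :
  is_hom h -> Co K B theta -> Co K A (preimage2 h theta).
Proof.
move=> hh [C Kt]; have C' := is_congruence_preimage2 hh C; split=> //.
have [Q KQ] := hK; apply/KQ => q Qq; apply/(satisfies_quotient _ C') => v prem.
have /(_ q Qq)/(satisfies_quotient _ C)/(_ (h \o v)) := (KQ _).1 Kt.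
rewrite /preimage2 /= !(eval_hom _ _ hh); apply=> e /prem.
by rewrite /preimage2 /= !(eval_hom _ _ hh).
Qed.

(** Pulled back along a homomorphism into a member of K, the diagonal shows that the kernel is a
    K-congruence. *)
Lemma Co_eq (A : structure S) : K A -> Co K A [set p | p.1 = p.2].
Proof.
move=> KA; have C : is_congruence [set p : A * A | p.1 = p.2].
  by split=> //= [a b c -> //|f a b ab]; congr interp; apply/funext.
split=> //; have [Q KQ] := hK; apply/KQ => q Qq.
by apply/(satisfies_quotient _ C) => v prem; exact: ((KQ A).1 KA q Qq v prem).
Qed.

Lemma Xi_mono (A : structure S) (F G : set A) :
  F `<=` G -> Xi K tau A F `<=` Xi K tau A G.
Proof.
move=> FG; apply/(Xi_adjoint _ _ (Xi_Co _ _ hK)).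
by apply: (subset_trans FG); apply/(Xi_adjoint _ _ (Xi_Co _ _ hK)).
Qed.

Lemma i_Xi (A : structure S) (F : set A) : F `<=` i_ tau A (Xi K tau A F).
Proof. by apply/(Xi_adjoint _ _ (Xi_Co _ _ hK)). Qed.

Lemma Xi_i (A : structure S) (theta : set (A * A)) :
  Co K A theta -> Xi K tau A (i_ tau A theta) `<=` theta.
Proof. by move=> Ct; apply/(Xi_adjoint _ _ Ct). Qed.

Lemma i_Xi_i (A : structure S) (theta : set (A * A)) :
  Co K A theta ->
  i_ tau A (Xi K tau A (i_ tau A theta)) = i_ tau A theta.
Proof.
move=> Ct; apply/seteqP; split; last exact: i_Xi.
by move=> a ia e te; apply: Xi_i => //; exact: ia.
Qed.

Lemma sub_Omega_i (A : structure S) (theta : set (A * A)) :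
  Co K A theta -> theta `<=` Omega A (i_ tau A theta).
Proof.
move=> [C _]; have [_ _] := Omega_largest (i_ tau A theta); apply=> //.
exact: i_compatible.
Qed.

(** The union [U] of all [Xi D] with D a finite subset of F is directed. It is again a K-congruence,
    because arities are finite and quasi-identities have finitely many premises. Since F lies in the
    image of [U] under [i_], the adjunction puts [Xi F] below [U]. *)
Lemma Xi_finitary (A : structure S) (F : set A) (p : A * A) :
  Xi K tau A F p ->
  exists2 D : set A, finite_set D /\ D `<=` F & Xi K tau A D p.
Proof.
pose fin (D : set A) := finite_set D /\ D `<=` F.
pose U : set (A * A) := [set p | exists2 D, fin D & Xi K tau A D p].
have CXi D : is_congruence (Xi K tau A D) by have [] := Xi_Co tau D hK.
have finU D E : fin D -> fin E -> fin (D `|` E).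
  move=> [fD DF] [fE EF]; split; first by rewrite finite_setU.
  by move=> x [/DF|/EF].
have C : is_congruence U.
  split.
  - move=> a; exists set0; last exact: (cong_refl (CXi _)).
    by split; [exact: finite_set0 | exact: sub0set].
  - by move=> a b [D fD ab]; exists D => //; apply: (cong_sym (CXi D)).
  - move=> a b c [D fD ab] [E fE bc]; exists (D `|` E); first exact: finU.
    apply: (cong_trans (CXi _) (b := b)).
      exact: (Xi_mono (@subsetUl _ D E) ab).
    exact: (Xi_mono (@subsetUr _ D E) bc).
  - move=> f a b ab.
    have [D DP] : {D : 'I_(arity f) -> set A &
        forall i, fin (D i) /\ Xi K tau A (D i) (a i, b i)}.
      apply: (@choice _ _
        (fun i D => fin D /\ Xi K tau A D (a i, b i))) => i.
      by have [D] := ab i; exists D.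
    exists (\bigcup_i D i).
      split; last by move=> x [i _]; have [[_ +] _] := DP i; apply.
      apply: bigcup_finite => [|i _]; first exact: finite_finset.
      by have [[]] := DP i.
    apply: (cong_interp (CXi _)) => i; have [_] := DP i; apply: Xi_mono.
    exact: bigcup_sup.
have CoU : Co K A U.
  split=> //; have [Q KQ] := hK; apply/KQ => q Qq.
  apply/(satisfies_quotient _ C) => v prem.
  have [D fD DP] : exists2 D, fin D & forall e, List.In e (premises q) ->
      Xi K tau A D (eval v e.1, eval v e.2).
    elim: (premises q) prem => [|e s IH] prem.
      by exists set0 => //; split; [exact: finite_set0 | exact: sub0set].
    have [|D fD DP] := IH; first by move=> e' se'; apply: prem; right.
    have [|E fE EP] := prem e; first by left.
    exists (D `|` E); first exact: finU.
    move=> e' [<-|/DP]; first exact: (Xi_mono (@subsetUr _ D E) EP).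
    exact: Xi_mono.
  exists D => //; have [CD /KQ/(_ q Qq)] := Xi_Co tau D hK.
  by move=> /(satisfies_quotient _ CD); apply.
have FU : F `<=` i_ tau A U.
  move=> a Fa e te; exists [set a].
    by split; [exact: finite_set1 | move=> _ ->].
  exact: (i_Xi (erefl : [set a] a)).
by move=> Xp; have [D] := (Xi_adjoint _ F CoU).2 FU _ Xp; exists D.
Qed.

Lemma eq_conseqP (X : Type) (Gamma : set (equation S X)) (e : equation S X) :
  eq_conseq K Gamma e <->
  (forall theta, Co K (Fm S X) theta -> Gamma `<=` theta -> theta e).
Proof.
split=> [Ge theta [C Kt] Gt|Ge A KA h hh Gh].
  rewrite (surjective_pairing e); apply/(clsP C).
  apply: (Ge _ Kt); first exact: cls_hom.
  by move=> [a b] /Gt ab; apply/(clsP C).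
by apply: (Ge _ (Co_preimage2 hh (Co_eq KA))) => g /Gh.
Qed.

(** * Defining K-congruences by formulas in two variables *)

Definition defines_equality (Delta : set (term S bool)) : Prop :=
  forall (A : structure S) (theta : set (A * A)), Co K A theta ->
  forall a b : A,
    theta (a, b) <-> (forall d, Delta d -> i_ tau A theta (t2 a b d)).

Lemma defines_equality_exists (X : Type) (p q : X) :
  p <> q ->
  (forall theta, Co K (Fm S X) theta ->
     Xi K tau (Fm S X) (i_ tau (Fm S X) theta) = theta) ->
  exists2 Delta, finite_set Delta & defines_equality Delta.
Proof.
move=> pq XiK.
pose theta0 : set (Fm S X * Fm S X) :=
  \bigcap_(theta in [set theta | Co K (Fm S X) theta /\
                                 theta (Var S p, Var S q)]) theta.
have C0 : Co K (Fm S X) theta0 by apply: Co_bigcap => // theta [].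
have : theta0 (Var S p, Var S q) by move=> theta [].
rewrite -[X in X (_, _)](XiK _ C0) => /Xi_finitary[D [finD Di] XiD].
(* The variable q becomes [false], the second variable; all others, p included, become [true]. The
   map [h] below is [merge] followed by evaluation at (a, b). *)
pose merge : Fm S X -> Fm S bool := eval (fun x => Var S (~~ `[< x = q >]) : Fm S bool).
exists (merge @` D); first exact: finite_image.
move=> A theta Ct a b.
pose h : Fm S X -> A := eval (fun x => if ~~ `[< x = q >] then a else b).
have hh : is_hom h := eval_is_hom _.
have hE phi : t2 a b (merge phi) = h phi.
  by rewrite /merge /t2 (eval_hom _ _ (eval_is_hom _)).
have Ch := Co_preimage2 hh Ct.
have hpq : preimage2 h theta (Var S p, Var S q) = theta (a, b).
  by rewrite /preimage2 /= /h /= asboolF // asboolT.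
(* If (a, b) is in theta, the inverse image of theta under [h] contains (p, q), hence [theta0].
   Conversely, if it satisfies D, it contains [Xi D], hence (p, q). *)
split=> [ab d [phi Dphi <-]|ab].
  rewrite hE -[i_ _ _ _ _]/((h @^-1` i_ tau A theta) phi) -i_preimage2 //.
  by move=> e te; apply: (Di _ Dphi e te); split=> //; rewrite hpq.
rewrite -hpq; apply: ((Xi_adjoint _ _ Ch).2 _ _ XiD).
by rewrite i_preimage2 // => phi Dphi /=; rewrite -hE; apply: ab; exists phi.
Qed.

Section DefinesEquality.
Context (Delta : set (term S bool)) (hDelta : defines_equality Delta).

Lemma Xi_iK (A : structure S) (theta : set (A * A)) :
  Co K A theta -> Xi K tau A (i_ tau A theta) = theta.
Proof.
move=> Ct; apply/seteqP; split; first exact: Xi_i.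
move=> [a b] /(hDelta Ct) ab.
by apply/(hDelta (Xi_Co _ _ hK)) => d /ab; exact: i_Xi.
Qed.

Lemma Omega_iK (A : structure S) (theta : set (A * A)) :
  Co K A theta -> theta = Omega A (i_ tau A theta).
Proof.
move=> Ct; apply/seteqP; split; first exact: sub_Omega_i.
have [C comp _] := Omega_largest (i_ tau A theta).
move=> [a b] ab; apply/(hDelta Ct) => d Dd.
(* Delta(a, a) is in the filter by reflexivity, and Omega relates it to Delta(a, b), so
   compatibility transfers membership. *)
apply: (comp (t2 a a d)).
  by have [+ _] := hDelta Ct a a; apply=> //; exact: (cong_refl Ct.1).
by apply: eval_cong => // -[] //; exact: (cong_refl C).
Qed.

(** * Filters of the logic, and algebraizability *)

Section Filter.
Context (X : Type) (f : nat -> X) (g : X -> nat) (fK : cancel f g).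
Context (A : structure S) (F : set A).
Context (filF : is_filter (assoc_logic K tau X) A F).

Definition Delta_cong : set (A * A) :=
  [set p | forall d, Delta d -> F (t2 p.1 p.2 d)].

(* The variables of Y are renamed into X; [a0] is the value of the variables
   of X outside the image of the renaming, which may be needed as A may be
   empty. *)
Lemma Delta_cong_rule (Y : countType) (a0 : A) (Gamma : set (equation S Y))
    (e : equation S Y) (w : Y -> A) :
  (forall (B : structure S) (theta : set (B * B)) (u : Y -> B), Co K B theta ->
     (forall c, Gamma c -> theta (eval u c.1, eval u c.2)) ->
     theta (eval u e.1, eval u e.2)) ->
  (forall c, Gamma c -> Delta_cong (eval w c.1, eval w c.2)) ->
  Delta_cong (eval w e.1, eval w e.2).
Proof.
move=> valid prem d Dd.
pose ren : Fm S Y -> Fm S X := @eval S Y (Fm S X) (@Var S X \o f \o pickle).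
pose v : Fm S X -> A := eval (fun x => oapp w a0 (unpickle (g x))).
have hv : is_hom v := eval_is_hom _.
have vren t : v (ren t) = eval w t.
  rewrite /ren (eval_hom _ _ hv); congr eval; apply/funext => y.
  by rewrite /v /= fK pickleK.
(* The translation of [Gamma] through Delta. By [valid], the logic derives the translation of [e]
   from it, and F is closed under this rule along [v]. *)
pose Gamma' : set (Fm S X) := [set phi | exists c d,
  [/\ Gamma c, Delta d & phi = @t2 _ (Fm S X) (ren c.1) (ren c.2) d]].
rewrite /= -!vren -(hom_t2 _ _ _ hv).
apply: (@filF Gamma' _ v) => // [theta Ct Gt|_ [_ [c [d' [Gc Dd' ->]]] <-]].
  apply: (hDelta Ct _ _).1 => //; apply: valid => // c Gc.
  by apply/(hDelta Ct) => d' Dd'; apply: Gt; exists c, d'.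
by rewrite (hom_t2 _ _ _ hv) !vren; exact: prem.
Qed.

Lemma Delta_cong_Co : Co K A Delta_cong.
Proof.
have C : is_congruence Delta_cong.
  split.
  - move=> a; apply: (@Delta_cong_rule unit a set0 (Var S tt, Var S tt)
      (fun=> a)) => // B theta u [C _] _.
    exact: (cong_refl C).
  - move=> a b ab; apply: (@Delta_cong_rule bool a
      [set (Var S true, Var S false)] (Var S false, Var S true)
      (fun x => if x then a else b)) => [B theta u [C _] ut|_ ->] //=.
    by apply: (cong_sym C); exact: (ut (Var S true, Var S false)).
  - move=> a b c ab bc.
    apply: (@Delta_cong_rule nat a
      [set (Var S 0, Var S 1); (Var S 1, Var S 2)] (Var S 0, Var S 2)
      (nth a [:: a; b; c])) => [B theta u [C _] ut|_ [->|->]] //=.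
    apply: (cong_trans C (b := u 1)).
      by apply: (ut (Var S 0, Var S 1)); left.
    by apply: (ut (Var S 1, Var S 2)); right.
  - move=> s a b ab.
    (* The default [interp A s a] exists even when [s] is nullary and has no argument to offer. *)
    apply: (@Delta_cong_rule (bool * 'I_(arity s))%type (interp A s a)
      [set (Var S (true, i), Var S (false, i)) | i in setT]
      (App (fun i => Var S (true, i)), App (fun i => Var S (false, i)))
      (fun x => if x.1 then a x.2 else b x.2))
      => [B theta u [C _] ut|_ [i _ <-]] //=.
    apply: (cong_interp C) => i; apply: (ut (Var S (true, i), Var S (false, i))).
    by exists i.
split=> //; have [Q KQ] := hK; apply/KQ => q Qq.
apply/(satisfies_quotient _ C) => v prem.
apply: (@Delta_cong_rule nat (v 0) [set e | List.In e (premises q)])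
  => // B theta u [CB /KQ/(_ q Qq)].
by move=> /(satisfies_quotient _ CB); apply.
Qed.

(** In the logic a variable x is interderivable with the formulas Delta(delta(x), epsilon(x)); both
    directions are applied with x evaluated at a. *)
Lemma i_Delta_cong : i_ tau A Delta_cong = F.
Proof.
pose x : Fm S X := Var S (f 0).
pose tr (e : equation S unit) d : Fm S X := t2 (t1 x e.1) (t1 x e.2) d.
have vtr a e d : eval (fun=> a) (tr e d) = t2 (t1 a e.1) (t1 a e.2) d.
  by rewrite (hom_t2 _ _ _ (eval_is_hom _)) !(hom_t1 _ _ (eval_is_hom _)).
apply/seteqP; split=> a.
  move=> ia; apply: (@filF [set phi | exists e d,
    [/\ tau e, Delta d & phi = tr e d]] x (eval (fun=> a))) => //.
    move=> theta Ct Gt e te; apply/(hDelta Ct) => d Dd.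
    by apply: Gt; exists e, d.
  by move=> _ [_ [e [d [te Dd ->]]] <-]; rewrite vtr; exact: ia.
move=> Fa e te d Dd /=; rewrite -vtr.
apply: (@filF [set x] (tr e d) (eval (fun=> a))) => // [theta Ct xi|_ [_ -> <-]] //.
by apply: (hDelta Ct _ _).1 => //; exact: (xi x erefl).
Qed.

Lemma Xi_filter : Xi K tau A F = Omega A F.
Proof.
have Ct := Delta_cong_Co.
by rewrite -i_Delta_cong (Xi_iK Ct) -(Omega_iK Ct).
Qed.

End Filter.

(** The witnesses are K, [tau] and Delta. By [eq_conseqP] all three conditions speak of
    K-congruences on formulas, where [tauP] and [DeltaP] turn formulas into equations and back. *)
Lemma assoc_logic_algebraizable (X : Type) :
  finite_set Delta -> algebraizable (assoc_logic K tau X).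
Proof.
move=> finD; exists K, tau, Delta => tau_ Delta_.
have tauP (theta : set (Fm S X * Fm S X)) phi :
    i_ tau (Fm S X) theta phi <-> tau_ phi `<=` theta.
  by split=> [ip _ [e te <-]|ip e te]; [exact: ip | apply: ip; exists e].
have DeltaP (theta : set (Fm S X * Fm S X)) (e : equation S X) :
    Co K (Fm S X) theta ->
    theta e <-> Delta_ e `<=` i_ tau (Fm S X) theta.
  move=> Ct; case: e => a b; split=> [/(hDelta Ct) ab _ [d Dd <-]|ab].
    exact: ab.
  by apply/(hDelta Ct) => d Dd; apply: ab; exists d.
split=> //.
- move=> Gamma phi; split=> [Gp e phie|Gp theta Ct Gt].
    apply/eq_conseqP => theta Ct Gt.
    apply: ((tauP _ _).1 (Gp theta Ct _)) => // gamma Gg.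
    by apply/tauP => c gc; apply: Gt; exists gamma.
  apply/tauP => e /Gp/eq_conseqP; apply=> // c [gamma /Gt/tauP]; exact.
- move=> Gamma e; split=> [/eq_conseqP Ge d ed theta Ct Gt|Ge].
    apply: ((DeltaP _ e Ct).1 _ _ ed); apply: Ge => // c Gc.
    by apply/DeltaP => // d' cd'; apply: Gt; exists c.
  apply/eq_conseqP => theta Ct Gt; apply/DeltaP => // d /Ge; apply=> //.
  by move=> d' [c /Gt/(DeltaP _ _ Ct)]; exact.
- move=> psi; split=> [d [e pe ed] theta Ct Gt|theta Ct Gt].
    apply: ((DeltaP _ e Ct).1 _ _ ed); apply: ((tauP _ psi).1 _ _ pe).
    exact: Gt.
  by apply/tauP => e pe; apply/DeltaP => // d ed; apply: Gt; exists e.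
Qed.

End DefinesEquality.

(** * Theories and the lattice isomorphism *)

Lemma i_theory (X : Type) (theta : set (Fm S X * Fm S X)) :
  Co K (Fm S X) theta ->
  is_theory (assoc_logic K tau X) (i_ tau (Fm S X) theta).
Proof. by move=> Ct phi; apply. Qed.

(** [Xi T] lies below every K-congruence whose image under [i_] contains T, so its own image
    consists of consequences of T. *)
Lemma theory_i_Xi (X : Type) (T : set (Fm S X)) :
  is_theory (assoc_logic K tau X) T ->
  i_ tau (Fm S X) (Xi K tau (Fm S X) T) = T.
Proof.
move=> thT; apply/seteqP; split; last exact: i_Xi.
move=> phi iphi; apply: thT => theta Ct Tt e te.
by apply: ((Xi_adjoint _ T Ct).2 Tt); exact: iphi.
Qed.

Lemma theory_filter (X : Type) (T : set (Fm S X)) :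
  is_theory (assoc_logic K tau X) T ->
  is_filter (assoc_logic K tau X) (Fm S X) T.
Proof.
move=> thT Gamma phi v Gp hv GT; apply: thT => theta Ct Tt.
have := Gp _ (Co_preimage2 hv Ct); rewrite i_preimage2 //; apply.
by move=> gamma Gg; apply: Tt; apply: GT; exists gamma.
Qed.

(** The inverse is [Xi] restricted to theories. Both maps are monotone, so meets and joins are
    preserved. *)
Lemma i_lattice_isomorphism (X : Type) :
  (forall theta, Co K (Fm S X) theta ->
     Xi K tau (Fm S X) (i_ tau (Fm S X) theta) = theta) ->
  lattice_isomorphism (Co K (Fm S X)) (is_theory (assoc_logic K tau X))
    (i_ tau (Fm S X)).
Proof.
move=> XiK.
have iS (x y : set (Fm S X * Fm S X)) :
    x `<=` y -> i_ tau (Fm S X) x `<=` i_ tau (Fm S X) y.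
  by move=> xy a ia e te; apply: xy; exact: ia.
have CXi := fun T => Xi_Co tau T hK.
split.
- split.
  + by move=> theta; exact: i_theory.
  + move=> x y /[!inE] Cx Cy ixy.
    by rewrite -(XiK x Cx) -(XiK y Cy) ixy.
  + move=> T thT; exists (Xi K tau (Fm S X) T); first exact: Xi_Co.
    exact: theory_i_Xi.
- move=> x y m Cx Cy [Cm mx my mmax]; split; [exact: i_theory|exact: iS|exact: iS|].
  move=> T thT Tx Ty; rewrite -(theory_i_Xi thT); apply: iS.
  by apply: mmax; [exact: CXi|exact/(Xi_adjoint _ _ Cx)|exact/(Xi_adjoint _ _ Cy)].
- move=> x y j Cx Cy [Cj xj yj jmin]; split; [exact: i_theory|exact: iS|exact: iS|].
  move=> T thT xT yT; rewrite -(theory_i_Xi thT); apply: iS.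
  apply: jmin; first exact: CXi.
    by rewrite -(XiK x Cx); exact: Xi_mono.
  by rewrite -(XiK y Cy); exact: Xi_mono.
Qed.

End Quasivariety.

Theorem theorem4p7 (S : signature) (K : structure S -> Prop)
    (hK : quasivariety K) (tau : set (equation S unit))
    (htau : finite_set tau) (X : Type) (hX : ([set: X] #= [set: nat])%card) :
  (forall (A : structure S) (theta : set (A * A)), Co K A theta ->
     Xi K tau A (i_ tau A theta) `<=` theta /\
     theta `<=` Omega A (i_ tau A theta)) /\
  [<->
       (forall theta, Co K (Fm S X) theta ->
          Xi K tau (Fm S X) (i_ tau (Fm S X) theta) = theta) \/
       (forall theta, Co K (Fm S X) theta ->
          theta = Omega (Fm S X) (i_ tau (Fm S X) theta));

       forall (A : structure S) (theta : set (A * A)), Co K A theta ->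
         Xi K tau A (i_ tau A theta) = theta /\
         theta = Omega A (i_ tau A theta);

       forall (A : structure S) (F : set A),
         is_filter (assoc_logic K tau X) A F -> Xi K tau A F = Omega A F;

       forall T : set (Fm S X),
         is_theory (assoc_logic K tau X) T ->
         Xi K tau (Fm S X) T = Omega (Fm S X) T;

       algebraizable (assoc_logic K tau X) /\
       (substitution_preserving (Co K (Fm S X)) (i_ tau (Fm S X)) /\
        lattice_isomorphism (Co K (Fm S X)) (is_theory (assoc_logic K tau X))
          (i_ tau (Fm S X)))].
Proof.
(* [f 0] and [f 1] will be the two distinct variables, and [g] undoes the renaming of variables into
   X. *)
have [f [g fK]] : exists (f : nat -> X) (g : X -> nat), cancel f g.
  have [g [_ _ surj]] := card_set_bijP hX.
  have [f fK] : {f : nat -> X & forall n, g (f n) = n}.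
    by apply: (@choice _ _ (fun n x => g x = n)) => n; have [x] := surj n I; exists x.
  by exists f, g.
have exDelta (XiK : forall theta, Co K (Fm S X) theta ->
    Xi K tau (Fm S X) (i_ tau (Fm S X) theta) = theta) :
    exists2 Delta, finite_set Delta & defines_equality K tau Delta.
  by apply: (@defines_equality_exists _ _ hK tau X (f 0) (f 1)) => // /(can_inj fK).
split=> [A theta Ct|].
  by split; [exact: Xi_i|exact: (sub_Omega_i tau Ct)].
tfae.
- case=> [XiK|OmegaK] A theta Ct; last first.
    have [|Delta _ hD] := exDelta.
      (* [eta] and [Xi] of its image are K-congruences with the same image under [i_], so both equal
         Omega of that image. *)
      move=> eta Ce; have CXi := Xi_Co tau (i_ tau _ eta) hK.
      by rewrite (OmegaK _ CXi) i_Xi_i // -OmegaK.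
    by split; [exact: (Xi_iK hK hD)|exact: (Omega_iK hD)].
  by have [Delta _ hD] := exDelta XiK; split; [exact: (Xi_iK hK hD)|exact: (Omega_iK hD)].
- move=> eqs A F filF; have [|Delta _ hD] := exDelta.
    by move=> theta Ct; have [] := eqs _ _ Ct.
  exact: (Xi_filter hK hD fK filF).
- by move=> XiO T thT; exact: (XiO _ _ (theory_filter hK thT)).
- move=> XiO; have XiK theta : Co K (Fm S X) theta ->
      Xi K tau (Fm S X) (i_ tau (Fm S X) theta) = theta.
    move=> Ct; apply/seteqP; split; first exact: Xi_i.
    by rewrite (XiO _ (i_theory Ct)); exact: (sub_Omega_i tau Ct).
  have [Delta finD hD] := exDelta XiK; split.
    exact: (assoc_logic_algebraizable hK hD).
  split; last exact: i_lattice_isomorphism.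
  by move=> sigma hs theta Ct; exact: i_preimage2.
(* Injectivity suffices: theta and [Xi] of its image have the same image under [i_]. *)
- move=> [_ [_ [[_ inj _] _ _]]]; left=> theta Ct.
  by apply: inj; rewrite ?inE ?i_Xi_i //; exact: Xi_Co.
Qed.
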